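(* Let $I\subseteq\mathbb R$ be an interval of prices, $D:I\to\mathbb R$ a differentiable demand function with $D'(p)<0$, and let $c\in\mathbb R$, $\beta\in(0,1)$, $J_S,J_B\in\mathbb R$. Consider the private objective $P$ and the social objective $W$ on $I$, given up to additive constants by $$P(p)=\big[p-c+\beta J_S\big]D(p),\qquad W(p)=\big[p-c+\beta(J_S+J_B)\big]D(p),$$ so that $P'(p)=D(p)+[p-c+\beta J_S]D'(p)$ and $W'(p)=D(p)+[p-c+\beta(J_S+J_B)]D'(p)$. Assume that $P$ and $W$ are strictly concave, that $P$ has an interior maximizer $p^P$, and that $W$ has a maximizer $p^W$. Then: (i) if $J_B>0$, then $p^W<p^P$; (ii) if $J_B<0$, then $p^W>p^P$; (iii) if the seller receives a transfer $s$ per completed transaction producing an eligible outcome, so that its objective becomes $[p-c+\beta J_S+s]D(p)$, then setting $s=\beta J_B$ makes the private price choice coincide with the social optimum $p^W$.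
   Context: Two-period welfare benchmark: $p$ is the current price, $c$ the marginal cost, $D(p)$ the probability of trade at price $p$, and $\beta$ the discount factor. $J_S$ is the seller's continuation information value of a completed transaction. $J_B$ is the later buyers' net information value of a completed transaction. Objectives are specified through their derivatives in $p$, as displayed. *)

(* Defs.v *)
From mathcomp Require Import all_boot all_order all_algebra.
From mathcomp Require Import all_classical all_reals all_analysis.
Import Order.TTheory GRing.Theory Num.Theory.
Import numFieldNormedType.Exports.

Set Implicit Arguments.
Unset Strict Implicit.
Unset Printing Implicit Defensive.

Local Open Scope classical_set_scope.
Local Open Scope ring_scope.

(* The difference quotient only samples points of I: this is the usual
   two-sided derivative at interior points of I and the one-sided derivative at
   an endpoint belonging to I. Values of f outside I are irrelevant, so a total
   f : R -> R encodes a function on I. *)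
Definition derivative_within (R : realType) (I : set R) (f : R -> R)
    (p d : R) : Prop :=
  (fun q => (f q - f p) / (q - p)) @ within I p^' --> d.

Definition strictly_concave_on (R : realType) (I : set R) (f : R -> R) : Prop :=
  forall x y t : R, I x -> I y -> x != y -> 0 < t -> t < 1 ->
    t * f x + (1 - t) * f y < f (t * x + (1 - t) * y).

Definition maximizer_on (R : realType) (I : set R) (f : R -> R) (p : R) : Prop :=
  I p /\ forall q, I q -> f q <= f p.

(* Main.v *)
(* At the interior maximizer pP the first-order condition P'(pP) = 0 leaves
   W'(pP) = beta * JB * D'(pP), whose sign is opposite to that of JB. The
   maximizer of a strictly concave function lies on the side of an interior
   point towards which its slope is positive, so this sign alone decides whether
   pW is below or above pP; neither the monotonicity of D on all of I nor a
   first-order condition at pW (which may be an endpoint of I) is involved. With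
   s = beta * JB the subsidized objective differs from W by a constant. *)

Require Import Defs.
From mathcomp Require Import all_boot all_order all_algebra.
From mathcomp Require Import all_classical all_reals all_analysis.
From mathcomp Require Import ring lra.
Import Order.TTheory GRing.Theory Num.Theory.
Import numFieldNormedType.Exports.

Local Open Scope classical_set_scope.
Local Open Scope ring_scope.

(** Product rule in a form shared by [P] and [W], whose margins differ only in the constant [a]. *)
Lemma derivative_within_affine_mul (R : realType) (I : set R) (D f : R -> R)
    (a k p d : R) : I p ->
  (forall q, I q -> f q = (q - a) * D q + k) ->
  derivative_within I D p d ->
  derivative_within I f p (D p + (p - a) * d).
Proof.
move=> Ip fE dD; rewrite /derivative_within.
have cid : (fun q : R => q) @ within I p^' --> p.
  apply: (@cvg_trans _ ((fun q : R => q) @ p^')).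
    exact/cvg_app/cvg_within.
  exact: (cvg_trans (cvg_app _ (@nbhs_dnbhs _ p))).
(* This form of the difference quotient of f avoids the continuity of D at p. *)
apply: (@cvg_trans _ ((fun q => D p + (q - a) * ((D q - D p) / (q - p)))
    @ within I p^')); last first.
  by apply: cvgD; [exact: cvg_cst | apply: cvgM dD; apply: cvgB cid (cvg_cst _)].
apply: near_eq_cvg; rewrite /within /= near_withinE.
near=> q => Iq.
have qp : q - p != 0 by rewrite subr_eq0; near: q; exact: nbhs_dnbhs_neq.
by rewrite !fE //; field.
Unshelve. all: by end_near. Qed.

(** Near [p] the slope dictates where [f] rises, while concavity keeps [f] from falling on the way
    to its maximizer. Allowing [x = p] makes Fermat's first-order condition a special case. *)
Lemma strictly_concave_maximizer_side (R : realType) (I : set R) (f : R -> R)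
    (p d x : R) : strictly_concave_on I f -> I° p ->
  derivative_within I f p d -> maximizer_on I f x -> d != 0 ->
  0 < d * (x - p).
Proof.
move=> fconc pI df [Ix fx] d0.
have Ip := interior_subset pI.
rewrite ltNge; apply/negP => dxp.
(* The factor [d] turns the limit into [d * d > 0], so both signs of the slope are treated at
   once. *)
have quot_gt0 : \forall q \near p, q != p -> 0 < d * ((f q - f p) / (q - p)).
  have : \forall q \near within I p^', 0 < d * ((f q - f p) / (q - p)).
    have dq : (fun q => d * ((f q - f p) / (q - p))) @ within I p^' --> d * d.
      by apply: cvgM df; exact: cvg_cst.
    by apply: (cvgr_gt _ dq); rewrite -expr2 exprn_even_gt0.
  (* Since [p] is interior, the restriction to [I] disappears near [p]. *)
  rewrite near_withinE /dnbhs near_withinE => H.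
  near=> q => qp.
  have Iq : I q by near: q.
  by move: qp Iq; near: q.
(* If x != p, take v = x - p: concavity gives f (p + t v) > f p; if x = p, take
   v = d: f increases from p in that direction. *)
have ray v : v != 0 ->
    exists t, [/\ 0 < t, t < 1, I (p + t * v) &
               0 < d * v * (f (p + t * v) - f p)].
  move=> v0.
  have ct : (fun t => p + t * v) @ (0 : R)^'+ --> p.
    rewrite -[X in _ --> X]addr0 -[X in _ --> _ + X](mul0r v).
    apply: cvgD; first exact: cvg_cst.
    apply: cvgM; last exact: cvg_cst.
    exact: cvg_at_right_filter.
  have : \forall t \near (0 : R)^'+, [/\ 0 < t, t < 1, I (p + t * v) &
      p + t * v != p -> 0 < d * ((f (p + t * v) - f p) / (p + t * v - p))].
    near=> t; split; near: t.
    - exact: nbhs_right_gt.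
    - exact: nbhs_right_lt.
    - exact: ct pI.
    - exact: ct quot_gt0.
  move/filter_ex => [t [t0 t1 It Ht]]; exists t; split=> //.
  have tv0 : t * v != 0 by rewrite mulf_neq0 // gt_eqF.
  have := Ht; rewrite -subr_eq0 addrAC subrr add0r => /(_ tv0) Hpos.
  (* The increment is a positive multiple, [t * v ^+ 2], of the signed quotient. *)
  have -> : d * v * (f (p + t * v) - f p) =
      t * v ^+ 2 * (d * ((f (p + t * v) - f p) / (t * v))).
    by field; rewrite v0 gt_eqF.
  by rewrite mulr_gt0 // mulr_gt0 // exprn_even_gt0.
have [xp|xp] := eqVneq x p.
  have [t [_ _ It]] := ray d d0.
  have dd : 0 < d * d by rewrite -expr2 exprn_even_gt0.
  by rewrite pmulr_rgt0 // subr_gt0 ltNge -{2}xp fx.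
have xp0 : x - p != 0 by rewrite subr_eq0.
have [t [t0 t1 It]] := ray _ xp0.
apply/negP; rewrite -leNgt mulr_le0_ge0 // subr_ge0.
have := fconc x p t Ix Ip xp t0 t1.
have -> : t * x + (1 - t) * p = p + t * (x - p) by ring.
move/ltW; apply: le_trans.
have := ler_wpM2l (ltW t0) (fx p Ip); lra.
Unshelve. all: by end_near. Qed.

(** The midpoint of two distinct maximizers would beat both. *)
Lemma strictly_concave_maximizer_uniq (R : realType) (I : set R) (f : R -> R)
    (x y : R) : is_interval I -> strictly_concave_on I f ->
  maximizer_on I f x -> maximizer_on I f y -> x = y.
Proof.
move=> Iint fconc [Ix fx] [Iy fy]; apply/eqP/negPn/negP => xy.
have h0 : 0 < 2^-1 :> R by lra.
have h1 : 2^-1 < 1 :> R by lra.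
have Im : I (2^-1 * x + (1 - 2^-1) * y).
  have [le_xy|/ltW le_yx] := leP x y.
    by apply: (Iint x y) => //; apply/andP; split; lra.
  by apply: (Iint y x) => //; apply/andP; split; lra.
have := fconc x y _ Ix Iy xy h0 h1; have := fx _ Im; have := fy x Ix.
lra.
Qed.

Theorem mainTheorem6 (R : realType) (I : set R) (D dD : R -> R)
    (c beta JS JB kP kW : R) (P W : R -> R) (pP pW : R)
    (I_interval : is_interval I)
    (D_deriv : forall p, I p -> derivative_within I D p (dD p))
    (D_decr : forall p, I p -> dD p < 0)
    (beta_gt0 : 0 < beta) (beta_lt1 : beta < 1)
    (P_def : forall p, I p -> P p = (p - c + beta * JS) * D p + kP)
    (W_def : forall p, I p -> W p = (p - c + beta * (JS + JB)) * D p + kW)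
    (P_concave : strictly_concave_on I P)
    (W_concave : strictly_concave_on I W)
    (pP_max : maximizer_on I P pP) (pP_interior : I° pP)
    (pW_max : maximizer_on I W pW) :
  [/\ 0 < JB -> pW < pP,
      JB < 0 -> pP < pW
    & forall (s kS : R) (Ps : R -> R),
        (forall p, I p -> Ps p = (p - c + beta * JS + s) * D p + kS) ->
        s = beta * JB ->
        forall p, maximizer_on I Ps p <-> p = pW].
Proof.
have Ip := interior_subset pP_interior.
have objective_deriv J k F : (forall p, I p -> F p = (p - c + beta * J) * D p + k) ->
    derivative_within I F pP (D pP + (pP - c + beta * J) * dD pP).
  move=> FE.
  have -> : pP - c + beta * J = pP - (c - beta * J) by ring.
  apply: (@derivative_within_affine_mul _ _ _ _ _ k) => //; last exact: D_deriv.
  by move=> q Iq; rewrite FE //; ring.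
(* A nonzero slope at the maximizer [pP] would give [0 < d * (pP - pP)]. *)
have P'0 : D pP + (pP - c + beta * JS) * dD pP = 0.
  apply/eqP/negPn/negP => /(strictly_concave_maximizer_side _ _ _ _ _ _
    P_concave pP_interior (objective_deriv _ _ _ P_def) pP_max).
  by rewrite subrr mulr0 ltxx.
have W'E : D pP + (pP - c + beta * (JS + JB)) * dD pP = beta * JB * dD pP.
  by rewrite -[RHS]add0r -P'0; ring.
have bD : beta * dD pP < 0 by rewrite pmulr_rlt0 // D_decr.
have side : JB != 0 -> JB * (pW - pP) < 0.
  (* Multiplying by the negative [beta * dD pP] makes [JB] into the slope of [W] at [pP]. *)
  move=> JB0; rewrite -(nmulr_rgt0 _ bD) mulrA (mulrAC beta) -W'E.
  apply: (strictly_concave_maximizer_side _ _ _ _ _ _ W_concave pP_interior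
    (objective_deriv _ _ _ W_def) pW_max).
  by rewrite W'E !mulf_neq0 ?(gt_eqF beta_gt0) ?(lt_eqF (D_decr _ Ip)).
split=> [JB0|JB0|s kS Ps PsE sE p].
- by have := side (lt0r_neq0 JB0); rewrite pmulr_rlt0 // subr_lt0.
- by have := side (ltr0_neq0 JB0); rewrite nmulr_rlt0 // subr_gt0.
have PsW q : I q -> Ps q = W q + (kS - kW).
  by move=> Iq; rewrite PsE // W_def // sE; ring.
have maxE x : maximizer_on I Ps x <-> maximizer_on I W x.
  by split=> -[Ix mx]; split=> // q Iq; have := mx q Iq; rewrite !PsW // lerD2r.
rewrite maxE; split=> [pmax|->//].
exact: strictly_concave_maximizer_uniq I_interval W_concave pmax pW_max.
Qed.
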